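(* Let $n\ge 2$ and let $(s_1,\dots,s_p)$ and $(t_1,\dots,t_q)$ be normal sequences of simple $n$-braids. Let $\mathcal D$ be the grid with vertices $(i,j)$, $0\le i\le p$, $0\le j\le q$ (where $i$ increases from left to right and $j$ increases from top to bottom), whose horizontal edge from $(i-1,j)$ to $(i,j)$ is labelled by a simple braid $h_{i,j}$ ($1\le i\le p$, $0\le j\le q$) and whose vertical edge from $(i,j-1)$ to $(i,j)$ is labelled by a simple braid $v_{i,j}$ ($0\le i\le p$, $1\le j\le q$), the labels being determined as follows: the bottom row is $h_{i,q}=s_i$ for $1\le i\le p$, the right column is $v_{p,j}=t_j$ for $1\le j\le q$, and, filling from right to left and from bottom to top, each elementary rectangle is a $C$-tile, i.e., for $1\le i\le p$ and $1\le j\le q$, $$h_{i,j-1}\,v_{i,j}=v_{i-1,j}\,h_{i,j}\quad\text{and}\quad \gcd\nolimits_L(h_{i,j-1},v_{i-1,j})=1 .$$ Let $d_{i,j}:=h_{i,j-1}v_{i,j}=v_{i-1,j}h_{i,j}$ be the label of the diagonal arrow from $(i-1,j-1)$ to $(i,j)$. (i) Every path in $\mathcal D$ consisting of diagonal arrows followed by horizontal arrows, as well as every path consisting of diagonal arrows followed by vertical arrows, corresponds to a normal sequence (the sequence of labels of the successive arrows of the path). (ii) Let $x=s_1\cdots s_p$ and $y=t_1\cdots t_q$. Let $(s'_1,\dots,s'_p):=(h_{1,0},\dots,h_{p,0})$ be the top row of $\mathcal D$, let $(t'_1,\dots,t'_q):=(v_{0,1},\dots,v_{0,q})$ be its left column,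 and, assuming $p\ge q$, let $(u_1,\dots,u_q):=(d_{1,1},\dots,d_{q,q})$ be the diagonal from the top-left corner. Then $(s'_1,\dots,s'_p)$ is the normal form of $x/y$, while $(t'_1,\dots,t'_q)$ is the normal form of $y/x$, and $(u_1,\dots,u_q,s_{q+1},\dots,s_p)$ is the normal form of the left lcm of $x$ and $y$.
   Context: $B_n$ is Artin's braid group with generators $\sigma_1,\dots,\sigma_{n-1}$ and relations $\sigma_i\sigma_j=\sigma_j\sigma_i$ for $|i-j|\ge2$, $\sigma_i\sigma_j\sigma_i=\sigma_j\sigma_i\sigma_j$ for $|i-j|=1$; $B_n^+$ is the submonoid generated by $\sigma_1,\dots,\sigma_{n-1}$ (positive braids). For $x,y\in B_n^+$, $x$ is a left divisor of $y$ if $y=xz$ for some $z\in B_n^+$, and $x$ is a right divisor of $y$ (equivalently, $y$ is a left multiple of $x$) if $y=zx$ for some $z\in B_n^+$. Any two $x,y\in B_n^+$ have a greatest common left divisor $\gcd_L(x,y)$ and a least common left multiple (left lcm) $\mathrm{lcm}_L(x,y)$. The left complement $x/y$ is the unique $x'\in B_n^+$ with $\mathrm{lcm}_L(x,y)=x'y$. $\Delta_n\in B_n^+$ is defined by $\Delta_1=1$, $\Delta_n=\sigma_1\sigma_2\cdots\sigma_{n-1}\Delta_{n-1}$. Simple braids are the left divisors of $\Delta_n$ in $B_n^+$ (which coincide with its right divisors). A sequence $(s_1,\dots,s_p)$ of simple braids is normal if, for each $k<p$, every $\sigma_i$ that is a left divisor of $s_{k+1}$ is a right divisor of $s_k$.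 Saying that $(s_1,\dots,s_p)$ is the normal form of a positive braid $x$ means that $(s_1,\dots,s_p)$ is normal and $x=s_1\cdots s_p$ (trailing entries equal to $1$ are allowed). Given simple $s,t$ (bottom and right edges), the $C$-tile they determine has top edge $s/t$ and left edge $t/s$, which are simple, so the grid is well defined. *)

(* Defs.v *)
From HB Require Import structures.
From mathcomp Require Import all_boot boolp.

Set Implicit Arguments.
Unset Strict Implicit.
Unset Printing Implicit Defensive.

Local Open Scope quotient_scope.
Local Open Scope group_scope.

(* Artin's braid group B_n, as the group presented by generators and
   relations.  The generators are indexed from 0: the ordinal i : 'I_n.-1
   stands for sigma_{i+1}.  A letter (i, false) is a generator and (i, true)
   is its formal inverse. *)

Definition braid_word (n : nat) := seq ('I_n.-1 * bool).

Inductive braid_equiv (n : nat) : braid_word n -> braid_word n -> Prop :=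
| braid_equiv_refl w : braid_equiv w w
| braid_equiv_sym w1 w2 : braid_equiv w1 w2 -> braid_equiv w2 w1
| braid_equiv_trans w1 w2 w3 :
    braid_equiv w1 w2 -> braid_equiv w2 w3 -> braid_equiv w1 w3
| braid_equiv_cat u w1 w2 v :
    braid_equiv w1 w2 -> braid_equiv (u ++ w1 ++ v) (u ++ w2 ++ v)
| braid_equiv_cancel i b : braid_equiv [:: (i, b); (i, ~~ b)] [::]
| braid_equiv_far (i j : 'I_n.-1) :
    (i.+1 < j) || (j.+1 < i) ->
    braid_equiv [:: (i, false); (j, false)] [:: (j, false); (i, false)]
| braid_equiv_near (i j : 'I_n.-1) :
    (i.+1 == j) || (j.+1 == i) ->
    braid_equiv [:: (i, false); (j, false); (i, false)]
                [:: (j, false); (i, false); (j, false)].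

Definition braid_equivb (n : nat) (w1 w2 : braid_word n) : bool :=
  `[< braid_equiv w1 w2 >].

Lemma braid_equivb_refl n : reflexive (@braid_equivb n).
Proof. by move=> w; apply/asboolP; exact: braid_equiv_refl. Qed.

Lemma braid_equivb_sym n : symmetric (@braid_equivb n).
Proof.
by move=> w1 w2; apply/asboolP/asboolP; exact: braid_equiv_sym.
Qed.

Lemma braid_equivb_trans n : transitive (@braid_equivb n).
Proof.
move=> w2 w1 w3 /asboolP e12 /asboolP e23; apply/asboolP.
exact: braid_equiv_trans e12 e23.
Qed.

Canonical braid_equiv_rel (n : nat) :=
  EquivRel (@braid_equivb n) (@braid_equivb_refl n) (@braid_equivb_sym n)
           (@braid_equivb_trans n).

Definition braid (n : nat) := {eq_quot (braid_equiv_rel n)}.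

HB.instance Definition _ (n : nat) := Choice.on (braid n).
HB.instance Definition _ (n : nat) := EqQuotient.on (braid n).

Definition braid_of_word (n : nat) (w : braid_word n) : braid n :=
  \pi_(braid n) w.

Definition braid_inv_word (n : nat) (w : braid_word n) : braid_word n :=
  rev [seq (l.1, ~~ l.2) | l <- w].

Definition braid_mul (n : nat) (x y : braid n) : braid n :=
  braid_of_word (repr x ++ repr y).
Definition braid_one (n : nat) : braid n := braid_of_word [::].
Definition braid_inv (n : nat) (x : braid n) : braid n :=
  braid_of_word (braid_inv_word (repr x)).

Lemma braid_of_wordP n (w1 w2 : braid_word n) :
  braid_of_word w1 = braid_of_word w2 <-> braid_equiv w1 w2.
Proof.
split=> [/eqmodP/asboolP // | e]; apply/eqmodP; exact/asboolP.
Qed.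

Lemma braid_of_wordK n (x : braid n) : braid_of_word (repr x) = x.
Proof. exact: reprK. Qed.

Lemma repr_braid_of_word n (w : braid_word n) :
  braid_equiv (repr (braid_of_word w)) w.
Proof. by apply/braid_of_wordP; rewrite braid_of_wordK. Qed.

Lemma braid_equiv_catlr n (u1 u2 v1 v2 : braid_word n) :
  braid_equiv u1 u2 -> braid_equiv v1 v2 ->
  braid_equiv (u1 ++ v1) (u2 ++ v2).
Proof.
move=> eu ev; apply: (@braid_equiv_trans _ _ (u2 ++ v1)).
  exact: (braid_equiv_cat [::] v1 eu).
by have := braid_equiv_cat u2 [::] ev; rewrite !cats0.
Qed.

Lemma braid_mulE n (u v : braid_word n) :
  braid_mul (braid_of_word u) (braid_of_word v) = braid_of_word (u ++ v).
Proof.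
by apply/braid_of_wordP; apply: braid_equiv_catlr; exact: repr_braid_of_word.
Qed.

Lemma braid_equiv_mulwV n (w : braid_word n) :
  braid_equiv (w ++ braid_inv_word w) [::].
Proof.
elim: w => [|[i b] w IHw]; first exact: braid_equiv_refl.
rewrite /braid_inv_word /= rev_cons -cats1 catA.
apply: (@braid_equiv_trans _ _ [:: (i, b); (i, ~~ b)]).
  exact: (braid_equiv_cat [:: (i, b)] [:: (i, ~~ b)] IHw).
exact: braid_equiv_cancel.
Qed.

Lemma braid_inv_wordK n : involutive (@braid_inv_word n).
Proof.
move=> w; rewrite /braid_inv_word map_rev revK -map_comp.
by rewrite map_id_in // => -[i b] _ /=; rewrite negbK.
Qed.

Lemma braid_equiv_mulVw n (w : braid_word n) :
  braid_equiv (braid_inv_word w ++ w) [::].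
Proof.
by have := braid_equiv_mulwV (braid_inv_word w); rewrite braid_inv_wordK.
Qed.

Lemma braid_mulA n : associative (@braid_mul n).
Proof.
move=> x y z; rewrite -(braid_of_wordK x) -(braid_of_wordK y).
by rewrite -(braid_of_wordK z) !braid_mulE catA.
Qed.

Lemma braid_mul1 n : left_id (@braid_one n) (@braid_mul n).
Proof. by move=> x; rewrite -(braid_of_wordK x) braid_mulE. Qed.

Lemma braid_mulr1 n : right_id (@braid_one n) (@braid_mul n).
Proof. by move=> x; rewrite -(braid_of_wordK x) braid_mulE cats0. Qed.

Lemma braid_mulV n : left_inverse (@braid_one n) (@braid_inv n) (@braid_mul n).
Proof.
move=> x; rewrite -{2}(braid_of_wordK x) braid_mulE.
by apply/braid_of_wordP; exact: braid_equiv_mulVw.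
Qed.

Lemma braid_mulrV n :
  right_inverse (@braid_one n) (@braid_inv n) (@braid_mul n).
Proof.
move=> x; rewrite -{1}(braid_of_wordK x) braid_mulE.
by apply/braid_of_wordP; exact: braid_equiv_mulwV.
Qed.

HB.instance Definition _ (n : nat) :=
  isGroup.Build (braid n) (@braid_mulA n) (@braid_mul1 n) (@braid_mulr1 n)
                (@braid_mulV n) (@braid_mulrV n).

Definition braid_gen (n : nat) (i : 'I_n.-1) : braid n :=
  braid_of_word [:: (i, false)].

(* The monoid B_n^+, as the submonoid of B_n generated by the sigma_i. *)

Definition positive (n : nat) : {pred braid n} :=
  fun x => `[< exists w : seq 'I_n.-1, x = \prod_(i <- w) braid_gen i >].

Lemma positive_closed n : monoid_closed (@positive n).
Proof.
split=> [|x y /asboolP [u ->] /asboolP [v ->]]; apply/asboolP.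
  by exists [::]; rewrite big_nil.
by exists (u ++ v); rewrite big_cat.
Qed.

Record pbraid (n : nat) :=
  PBraid { braid_of_pbraid : braid n; _ : braid_of_pbraid \in @positive n }.

HB.instance Definition _ (n : nat) := [isSub for @braid_of_pbraid n].
HB.instance Definition _ (n : nat) := [Choice of pbraid n by <:].
HB.instance Definition _ (n : nat) :=
  SubChoice_isSubMonoid.Build (braid n) (@positive n) (pbraid n)
    (@positive_closed n).

Lemma braid_gen_positive n (i : 'I_n.-1) : braid_gen i \in @positive n.
Proof. by apply/asboolP; exists [:: i]; rewrite big_seq1. Qed.

Definition sigma (n : nat) (i : 'I_n.-1) : pbraid n :=
  PBraid (braid_gen_positive i).

Section Divisibility.
Variable M : monoidType.
Implicit Types x y d m : M.

Definition ldiv x y := exists z, y = x * z.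

(* equivalently, y is a left multiple of x *)
Definition rdiv x y := exists z, y = z * x.

Definition is_gcdL x y d :=
  [/\ ldiv d x, ldiv d y & forall e, ldiv e x -> ldiv e y -> ldiv e d].

Definition is_lcmL x y m :=
  [/\ rdiv x m, rdiv y m & forall e, rdiv x e -> rdiv y e -> rdiv m e].

(* z is the left complement x / y; not to be confused with the group division
   denoted by / in group_scope *)
Definition is_lcompl x y z := is_lcmL x y (z * y).

End Divisibility.

(* The element Delta_k of B_k^+, viewed in B_n^+ (for k <= n).  The product is
   taken in increasing order of i; it is sigma_1 ... sigma_{k'} for
   k = k'.+1, because of the indexing from 0. *)
Fixpoint Delta_rec (n k : nat) : pbraid n :=
  if k is k'.+1 then (\prod_(i < n.-1 | i < k') sigma i) * Delta_rec n k'
  else 1.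

Definition Delta (n : nat) : pbraid n := Delta_rec n n.

Definition simple (n : nat) (x : pbraid n) := ldiv x (Delta n).

(* The entry s_{k+1} of the sequence is nth 1 s k. *)
Definition normal (n : nat) (s : seq (pbraid n)) :=
  {in s, forall x, simple x} /\
  (forall k, k.+1 < size s -> forall i : 'I_n.-1,
     ldiv (sigma i) (nth 1 s k.+1) -> rdiv (sigma i) (nth 1 s k)).

Definition is_normal_form (n : nat) (x : pbraid n) (s : seq (pbraid n)) :=
  normal s /\ x = \prod_(u <- s) u.

(* h i j is the label of the horizontal edge from (i-1, j) to (i, j), for
   1 <= i <= p and 0 <= j <= q, and v i j is the label of the vertical edge
   from (i, j-1) to (i, j), for 0 <= i <= p and 1 <= j <= q; the values of h
   and v outside these ranges are irrelevant. *)
Record is_grid (n p q : nat) (s : p.-tuple (pbraid n)) (t : q.-tuple (pbraid n))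
    (h v : nat -> nat -> pbraid n) : Prop := IsGrid {
  grid_simple_h : forall i j, 1 <= i <= p -> 0 <= j <= q -> simple (h i j);
  grid_simple_v : forall i j, 0 <= i <= p -> 1 <= j <= q -> simple (v i j);
  grid_bottom : forall i, 1 <= i <= p -> h i q = nth 1 s i.-1;
  grid_right : forall j, 1 <= j <= q -> v p j = nth 1 t j.-1;
  grid_tile : forall i j, 1 <= i <= p -> 1 <= j <= q ->
    h i j.-1 * v i j = v i.-1 j * h i j /\ is_gcdL (h i j.-1) (v i.-1 j) 1
}.

(* label of the diagonal arrow from (i-1, j-1) to (i, j) *)
Definition diag (n : nat) (h v : nat -> nat -> pbraid n) (i j : nat) :
  pbraid n := h i j.-1 * v i j.

(* Main.v *)
From Corelib Require Import Setoid Morphisms.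
Require Import Defs.
From mathcomp Require Import all_boot boolp zify.

Set Implicit Arguments.
Unset Strict Implicit.
Unset Printing Implicit Defensive.

(** Call a pair [(a, b)] greedy when [a] contains every simple left divisor of
    [a * b].  For simple [a] this is the same as normality of the pair
    ([greedyP]), and it can be pushed through a grid of tiles by pure
    divisibility arguments:
    - [a] may be multiplied on the left as long as the product stays simple
      ([greedy_mull]); hence a diagonal followed by the edge that continues the
      bottom edge of its tile is a greedy pair as soon as the bottom row is;
    - the top row inherits greediness from the bottom row ([greedy_top]),
      because a simple divisor of the top row is contained in the diagonal and
      the tile condition on greatest common divisors confines it to the first
      edge;
    - two consecutive diagonals are greedy ([greedy_diagonal]), because a simple
      divisor reaching into the second one would meet both the top and the left
      edge of its tile.
    The second part of the proposition holds because each tile is a left least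
    common multiple of its bottom and right edges ([tile_lcm_square]) and such
    squares can be pasted together ([lcm_square_row], [lcm_square_col]).

    These arguments use only cancellation, the existence of enough common
    multiples in the form of an interpolation property ([ldiv_interp],
    [rdiv_interp]), the equality of left and right divisors of [Delta]
    ([simple_rdiv]), and the fact that a simple braid [x] can be extended by a
    letter to a simple braid exactly when it does not end with that letter
    ([simple_square], [simple_extend]).

    Interpolation follows from Garside's theorem ([garside]) on words that are
    congruent and start with different letters, which is a statement on the
    monoid presented by the braid relations.  It applies to the submonoid of the
    braid group because that monoid embeds in the group
    ([positive_embedding]): the square of [Delta] is central and divisible by
    every letter, so inverse letters can be cleared by multiplying with powers
    of it.  The right-handed versions come from reversing words.  Finally,
    [Delta] contains no square of a letter because the braid relations act on
    sequences by sorting steps ([sort_by]), for which [Delta] is defined on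
    increasing sequences and squares are not. *)

(** * The monoid presented by the braid relations *)

(** Congruence of positive words on countably many strands: the letter [i]
    stands for the generator number [i], and a word on [n] strands is one whose
    letters are all below [n.-1]. *)
Inductive beq : seq nat -> seq nat -> Prop :=
| beq_refl w : beq w w
| beq_sym u v : beq u v -> beq v u
| beq_trans u v w : beq u v -> beq v w -> beq u w
| beq_cat a u v b : beq u v -> beq (a ++ u ++ b) (a ++ v ++ b)
| beq_far i j : i.+1 < j -> beq [:: i; j] [:: j; i]
| beq_near i : beq [:: i; i.+1; i] [:: i.+1; i; i.+1].

Infix "=b" := beq (at level 70).

#[export] Hint Resolve beq_refl : core.

#[export] Instance beq_equivalence : Equivalence beq.
Proof. by split; [exact: beq_refl | exact: beq_sym | exact: beq_trans]. Qed.

#[export] Instance cons_beq_proper i : Proper (beq ==> beq) (cons i).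
Proof.
by move=> u v e; have := beq_cat [:: i] [::] e; rewrite /= !cats0.
Qed.

#[export] Instance cat_beq_proper : Proper (beq ==> beq ==> beq) cat.
Proof.
move=> u u' eu v v' ev; apply: (beq_trans (beq_cat [::] v eu)).
by have := beq_cat u' [::] ev; rewrite !cats0.
Qed.

Definition far i j := (i.+1 < j) || (j.+1 < i).
Definition near i j := (i.+1 == j) || (j.+1 == i).

Lemma beq_swap i j w : far i j -> i :: j :: w =b j :: i :: w.
Proof.
case/orP=> [/beq_far|/beq_far/beq_sym] e.
  exact: (beq_cat [::] w e).
exact: (beq_cat [::] w e).
Qed.

Lemma beq_braid i j w : near i j -> i :: j :: i :: w =b j :: i :: j :: w.
Proof.
case/orP=> /eqP <-; first exact: (beq_cat [::] w (beq_near i)).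
exact: (beq_cat [::] w (beq_sym (beq_near j))).
Qed.

Lemma beq_size u v : u =b v -> size u = size v.
Proof. by elim=> // *; rewrite ?size_cat; lia. Qed.

Lemma beq_all (P : pred nat) u v : u =b v -> all P u = all P v.
Proof.
elim=> [//|//|u' v' w _ -> _ -> //|a u' v' b _ e|i j _|i] /=.
- by rewrite !all_cat e.
- exact: andbCA.
- by case: (P i); case: (P i.+1).
Qed.

Lemma beq_rev u v : u =b v -> rev u =b rev v.
Proof.
elim=> [w|u' v' _|u' v' w _ e1 _ e2|a u' v' b _ e|i j ij|i].
- exact: beq_refl.
- exact: beq_sym.
- exact: beq_trans e1 e2.
- by rewrite !rev_cat e.
- exact/beq_sym/beq_far.
- exact: beq_near.
Qed.

Lemma beq_nil u : u =b [::] -> u = [::].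
Proof. by move/beq_size/size0nil. Qed.

(** * Garside's theorem on two initial letters *)

(** [comp_letter i j] completes the letter [i] into the least common right
    multiple of the letters [i] and [j]. *)
Definition comp_letter i j :=
  if i == j then [::] else if near i j then [:: j; i] else [:: j].

Lemma comp_letter_id i : comp_letter i i = [::].
Proof. by rewrite /comp_letter eqxx. Qed.

Lemma comp_letter_near i j : near i j -> comp_letter i j = [:: j; i].
Proof.
move=> ij; rewrite /comp_letter ij.
by case: eqP ij => // ->; rewrite /near; lia.
Qed.

Lemma comp_letter_far i j : far i j -> comp_letter i j = [:: j].
Proof.
move=> ij; rewrite /comp_letter; have -> : near i j = false.
  by move: ij; rewrite /far /near; lia.
by case: eqP ij => // ->; rewrite /far; lia.
Qed.

Lemma far_sym i j : far i j -> far j i. Proof. by rewrite /far orbC. Qed.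
Lemma near_sym i j : near i j -> near j i. Proof. by rewrite /near orbC. Qed.

Variant letters_spec i j : bool -> Prop :=
| LettersEq of i = j : letters_spec i j true
| LettersFar of far i j : letters_spec i j false
| LettersNear of near i j : letters_spec i j false.

Lemma lettersP i j : letters_spec i j (i == j).
Proof.
case: eqP => [|ne]; first exact: LettersEq.
case nij: (near i j); first exact: LettersNear.
by apply: LettersFar; move: nij ne; rewrite /near /far; lia.
Qed.

Definition factors_through i u j v :=
  exists2 w, u =b comp_letter i j ++ w & v =b comp_letter j i ++ w.

Lemma factors_sym i u j v : factors_through i u j v -> factors_through j v i u.
Proof. by case=> w e1 e2; exists w. Qed.

Section GarsideTransitivity.
(* Garside's theorem for words of length at most N. *)
Variable N : nat.
Hypothesis short_factors : forall i u j v,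
  i :: u =b j :: v -> size u < N -> factors_through i u j v.

Lemma short_cancel i u v : i :: u =b i :: v -> size u < N -> u =b v.
Proof.
by move=> e /(short_factors e) [w]; rewrite comp_letter_id /= => -> ->.
Qed.

Lemma short_far i u j v : far i j ->
  i :: u =b j :: v -> size u < N -> exists2 w, u =b j :: w & v =b i :: w.
Proof.
move=> ij e /(short_factors e) [w].
by rewrite (comp_letter_far ij) (comp_letter_far (far_sym ij)); exists w.
Qed.

Lemma short_near i u j v : near i j ->
  i :: u =b j :: v -> size u < N ->
  exists2 w, u =b j :: i :: w & v =b i :: j :: w.
Proof.
move=> ij e /(short_factors e) [w].
by rewrite (comp_letter_near ij) (comp_letter_near (near_sym ij)); exists w.
Qed.

(** The middle letter is far from the first one and near the second one. *)
Lemma factors_trans_far_near i u k j v w1 w2 :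
  far i k -> near k j -> i != j -> size u <= N ->
  u =b k :: w1 -> v =b k :: j :: w2 -> i :: w1 =b j :: k :: w2 ->
  factors_through i u j v.
Proof.
move=> ik kj; case: lettersP => // ij _ szu eu ev e;
  have szw1 : size w1 < N by move: (beq_size eu) => /= <-.
- have [w3 e1 e3] := short_far ij e szw1.
  have szw2 : size w2 < N by move: (beq_size e) => /=; lia.
  have [w4 e2 e4] := short_far (far_sym ik) e3 szw2.
  exists (k :: j :: w4).
    by rewrite (comp_letter_far ij) /= eu e1 e4 (beq_braid _ kj).
  rewrite (comp_letter_far (far_sym ij)) /= ev e2.
  by rewrite (beq_swap _ (far_sym ij)) (beq_swap _ (far_sym ik)).
- have [w3 e1 e3] := short_near ij e szw1.
  have szw2 : size w2 < N by move: (beq_size e) => /=; lia.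
  have [w4 e2 e4] := short_far (far_sym ik) e3 szw2.
  have szw3 : size w3 < N by move: (beq_size e1) => /=; lia.
  have [w5 e5 e6] := short_near (near_sym kj) e4 szw3.
  exists (k :: j :: i :: w5).
    rewrite (comp_letter_near ij) /= eu e1 e5.
    rewrite (beq_swap (j :: w5) ik) (beq_braid [:: i, j & w5] kj).
    by rewrite -(beq_braid w5 ij) (beq_swap [:: j, i & w5] (far_sym ik)).
  rewrite (comp_letter_near (near_sym ij)) /= ev e2 e6.
  rewrite -(beq_braid (k :: w5) ij) (beq_swap [:: j, i, k & w5] (far_sym ik)).
  by rewrite (beq_swap w5 ik) (beq_braid (i :: w5) kj).
Qed.

Lemma short_cancel_cat a u v :
  a ++ u =b a ++ v -> size (a ++ u) <= N -> u =b v.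
Proof.
elim: a => //= i a IH e sz.
by apply: IH (ltnW sz); apply: short_cancel e sz.
Qed.

(** The middle letter is near both others, which are then far apart: no three
    letters are pairwise near. *)
Lemma factors_trans_near_near i u k j v w1 w2 :
  near i k -> near k j -> i != j -> size u <= N ->
  u =b k :: i :: w1 -> v =b k :: j :: w2 -> i :: k :: w1 =b j :: k :: w2 ->
  factors_through i u j v.
Proof.
move=> ik kj ne szu eu ev e.
have ij : far i j by move: ik kj ne; rewrite /near /far; lia.
have szw1 : (size w1).+2 <= N by move: (beq_size eu) => /= <-.
have szw2 : (size w2).+2 <= N by move: (beq_size e) => /= [<-].
have [w3 e1 e2] := short_far ij e szw1.
have [w4 e3 e4] := short_near (near_sym ik) e2 (ltnW szw2).
have [w5 e5 e6] := short_near kj e1 (ltnW szw1).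
have szw3 : (size w3).+1 < N by move: (beq_size e1) => /= [<-].
have szw4 : (size w4).+3 < N by move: (beq_size e4) szw3 => /= ->.
have e7 : i :: w4 =b j :: w5.
  by apply: (@short_cancel k); [rewrite -e4 -e6 | rewrite /=; lia].
have szw4' : size w4 < N by lia.
have [w6 e8 e9] := short_far ij e7 szw4'.
exists (k :: i :: j :: k :: w6).
  rewrite (comp_letter_far ij) /= eu e5 e9.
  rewrite (beq_swap [:: k, i & w6] ij) (beq_braid w6 ik).
  by rewrite (beq_braid [:: i, k & w6] kj) (beq_swap (k :: w6) (far_sym ij)).
rewrite (comp_letter_far (far_sym ij)) /= ev e3 e8.
rewrite (beq_swap [:: k, j & w6] (far_sym ij)).
rewrite (beq_braid w6 (near_sym kj)).
by rewrite (beq_braid [:: j, k & w6] (near_sym ik)).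
Qed.

Lemma cons_comp_letter_far k i j w : far k i -> far k j ->
  k :: comp_letter i j ++ w =b comp_letter i j ++ k :: w.
Proof.
move=> ki kj; rewrite /comp_letter; case: ifP => // _; case: ifP => _ /=.
  by rewrite (beq_swap _ kj) (beq_swap _ ki).
by rewrite (beq_swap _ kj).
Qed.

(** The cube condition on the letters [i], [k] and [j]. *)
Lemma factors_trans i u k t j v : size t <= N ->
  i :: u =b k :: t -> factors_through i u k t -> factors_through k t j v ->
  factors_through i u j v.
Proof.
move=> szt eit fik fkj.
have szu : size u <= N by move: (beq_size eit) => /= [->].
case: (eqVneq i k) eit fik fkj => [<- eit [w]|ik eit [w1 eu et] fkj].
  rewrite comp_letter_id /= => eu et [w' et' ev]; exists w' => //.
  exact: beq_trans eu (beq_trans (beq_sym et) et').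
case: (eqVneq k j) fkj => [<- [w]|kj [w2 et' ev]].
  rewrite comp_letter_id /= => et' ev; exists w1 => //.
  exact: beq_trans ev (beq_trans (beq_sym et') et).
have e : comp_letter k i ++ w1 =b comp_letter k j ++ w2 by rewrite -et et'.
case: (eqVneq i j) => [ij|ij].
  subst j; exists u; rewrite comp_letter_id //= ev eu.
  suff -> : w1 =b w2 by [].
  by apply: short_cancel_cat e _; rewrite -(beq_size et).
case: (lettersP i k) ik eu et e => // ik _ eu et e;
  case: (lettersP k j) kj ev et' e => // kj _ ev et' e.
- rewrite (comp_letter_far (far_sym ik)) (comp_letter_far kj) /= in e et et'.
  have szw1 : size w1 < N by move: (beq_size et) => /= <-.
  have [w3 e1 e2] := short_factors e szw1.
  exists (k :: w3).
    rewrite eu (comp_letter_far ik) /= e1.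
    by rewrite (cons_comp_letter_far _ (far_sym ik) kj).
  rewrite ev (comp_letter_far (far_sym kj)) /= e2.
  by rewrite (cons_comp_letter_far _ kj (far_sym ik)).
- rewrite (comp_letter_far (far_sym ik)) (comp_letter_near kj) /= in e.
  rewrite (comp_letter_far ik) in eu.
  rewrite (comp_letter_near (near_sym kj)) in ev.
  exact: factors_trans_far_near eu ev e.
- rewrite (comp_letter_near (near_sym ik)) (comp_letter_far kj) /= in e.
  rewrite (comp_letter_near ik) in eu.
  rewrite (comp_letter_far (far_sym kj)) in ev.
  have szv : size v <= N.
    rewrite (beq_size ev) /=.
    by move: (beq_size eu) (beq_size e) szu => /=; lia.
  apply: factors_sym.
  apply: (factors_trans_far_near (far_sym kj) (near_sym ik) _ szv ev eu).
    by rewrite eq_sym.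
  exact: beq_sym.
- rewrite (comp_letter_near (near_sym ik)) (comp_letter_near kj) /= in e.
  rewrite (comp_letter_near ik) in eu.
  rewrite (comp_letter_near (near_sym kj)) in ev.
  exact: (factors_trans_near_near ik kj ij szu eu ev e).
Qed.
End GarsideTransitivity.

(** Garside's theorem.  The outer induction on length provides the theorem for
    the shorter words that the cube condition meets; the inner one on the
    derivation reduces the claim to one application of a relation. *)
Theorem garside i u j v : i :: u =b j :: v -> factors_through i u j v.
Proof.
suff main N : forall x y, x =b y -> size x <= N ->
    forall i u j v, x = i :: u -> y = j :: v -> factors_through i u j v.
  by move=> e; apply: (main (size (i :: u)) _ _ e).
elim: N => [|N IHN] x y; first by case: x.
have short i' u' j' v' : i' :: u' =b j' :: v' -> size u' < N ->
    factors_through i' u' j' v'.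
  by move=> e sz; apply: (IHN _ _ e).
elim=> {x y} [w|x y exy IH|x z y exz IHx ezy IHy|a x y b exy IH|k l kl|k] sz.
- move=> i' u' j' v' -> [-> ->]; exists v'; by rewrite comp_letter_id.
- move=> i' u' j' v' ey ex; apply: factors_sym; apply: IH ex ey.
  by rewrite (beq_size exy).
- move=> i' u' j' v' ex ey; subst x y.
  case: z exz ezy IHx IHy => [/beq_nil //|k t] exz ezy IHx IHy.
  have szt : size t <= N by move: (beq_size exz) sz => /= [->].
  apply: (factors_trans short szt exz); first exact: IHx.
  by apply: IHy.
- case: a sz => [|k a] sz i' u' j' v' /=; last first.
    move=> [<- <-] [<- <-]; exists (a ++ y ++ b); rewrite comp_letter_id //=.
    exact: beq_cat.
  case: x exy IH sz => [/beq_sym/beq_nil ->|k x] /=.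
    by move=> _ _ -> [-> ->]; exists v'; rewrite comp_letter_id.
  case: y => [/beq_nil //|l y] exy IH sz [<- <-] [<- <-].
  have [|w e1 e2] := IH _ k x l y erefl erefl.
    by move: sz; rewrite /= size_cat; lia.
  by exists (w ++ b); [rewrite e1 catA | rewrite e2 catA].
- move=> i' u' j' v' [<- <-] [<- <-]; exists [::]; rewrite comp_letter_far //.
    by rewrite /far kl.
  by rewrite /far kl orbT.
- move=> i' u' j' v' [<- <-] [<- <-]; exists [::]; rewrite comp_letter_near //.
    by rewrite /near eqxx.
  by rewrite /near eqxx orbT.
Qed.

Lemma garside_far i u j v : far i j ->
  i :: u =b j :: v -> exists2 w, u =b j :: w & v =b i :: w.
Proof.
move=> ij /garside [w].
by rewrite (comp_letter_far ij) (comp_letter_far (far_sym ij)); exists w.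
Qed.

Lemma garside_near i u j v : near i j -> i :: u =b j :: v ->
  exists2 w, u =b j :: i :: w & v =b i :: j :: w.
Proof.
move=> ij /garside [w].
by rewrite (comp_letter_near ij) (comp_letter_near (near_sym ij)); exists w.
Qed.

Lemma beq_catI a u v : a ++ u =b a ++ v -> u =b v.
Proof.
elim: a => //= i a IH /garside [w]; rewrite comp_letter_id => e1 e2.
by apply: IH; rewrite e1 e2.
Qed.

Lemma beq_catIr a u v : u ++ a =b v ++ a -> u =b v.
Proof.
move/beq_rev; rewrite !rev_cat => /beq_catI/beq_rev; by rewrite !revK.
Qed.

(** * Interpolation of divisors *)

Definition ldvd a x := exists c, x =b a ++ c.

#[export] Instance ldvd_proper : Proper (beq ==> beq ==> iff) ldvd.
Proof.
move=> a a' ea x x' ex.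
by split=> -[c e]; exists c; [rewrite -ex -ea | rewrite ex ea].
Qed.

Lemma ldvd_cat a c : ldvd a (a ++ c). Proof. by exists c. Qed.

Lemma ldvd_refl a : ldvd a a. Proof. by exists [::]; rewrite cats0. Qed.

Lemma ldvd_trans a b x : ldvd a b -> ldvd b x -> ldvd a x.
Proof. by case=> c e [d e']; exists (c ++ d); rewrite e' e catA. Qed.

Lemma ldvd_cat2l a u v : ldvd (a ++ u) (a ++ v) <-> ldvd u v.
Proof.
split=> -[c e]; exists c; last by rewrite e catA.
by move: e; rewrite -catA => /beq_catI.
Qed.

Lemma cons_comp_letter i j w :
  i :: comp_letter i j ++ w =b j :: comp_letter j i ++ w.
Proof.
case: (lettersP i j) => [-> //|ij|ij].
  rewrite (comp_letter_far ij) (comp_letter_far (far_sym ij)).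
  exact: beq_swap.
rewrite (comp_letter_near ij) (comp_letter_near (near_sym ij)).
exact: beq_braid.
Qed.

(** This property combines the existence of greatest common divisors with that
    of conditional least common multiples.  The completion of the initial
    letters of [a] and [b] divides [x] and [y]; interpolating it with [a], then
    with [b], and finally the two results, takes place on shorter words. *)
Lemma ldvd_interp a b x y :
  ldvd a x -> ldvd b x -> ldvd a y -> ldvd b y ->
  exists m, [/\ ldvd a m, ldvd b m, ldvd m x & ldvd m y].
Proof.
have [N leN] := ubnP (size x); elim: N => // N IH in a b x y leN *.
case: a => [|i a] ax bx ay by_.
  by exists b; split=> //; [exact: ldvd_cat | exact: ldvd_refl].
case: b bx by_ => [|j b] bx by_.
  by exists (i :: a); split=> //; [exact: ldvd_refl | exact: ldvd_cat].
case: ax bx ay by_ => [xa exa] [xb exb] [ya eya] [yb eyb].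
have [wx ex1 ex2] : factors_through i (a ++ xa) j (b ++ xb).
  exact/garside/(beq_trans (beq_sym exa) exb).
have [wy ey1 ey2] : factors_through i (a ++ ya) j (b ++ yb).
  exact/garside/(beq_trans (beq_sym eya) eyb).
have szxa : size (a ++ xa) < N by move: (beq_size exa) leN => /= ->.
have szxb : size (b ++ xb) < N by move: (beq_size exb) leN => /= ->.
have szwx : size wx < N.
  by apply: leq_ltn_trans szxa; rewrite (beq_size ex1) size_cat leq_addl.
have [||||m1 [am1 [c1 em1] m1x m1y]] :=
  IH a (comp_letter i j) (a ++ xa) (a ++ ya) szxa.
- exact: ldvd_cat.
- by exists wx.
- exact: ldvd_cat.
- by exists wy.
have [||||m2 [bm2 [c2 em2] m2x m2y]] :=
  IH b (comp_letter j i) (b ++ xb) (b ++ yb) szxb.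
- exact: ldvd_cat.
- by exists wx.
- exact: ldvd_cat.
- by exists wy.
move: m1x m1y m2x m2y; rewrite ex1 ey1 ex2 ey2 em1 em2 !ldvd_cat2l.
move=> c1x c1y c2x c2y.
have [m3 [c1m c2m m3x m3y]] := IH c1 c2 wx wy szwx c1x c2x c1y c2y.
exists (i :: comp_letter i j ++ m3); split.
- apply: (@ldvd_trans _ (i :: m1)); first exact: (ldvd_cat2l [:: i] a m1).2.
  by rewrite em1; apply/(ldvd_cat2l [:: i])/ldvd_cat2l.
- rewrite cons_comp_letter.
  apply: (@ldvd_trans _ (j :: m2)); first exact: (ldvd_cat2l [:: j] b m2).2.
  by rewrite em2; apply/(ldvd_cat2l [:: j])/ldvd_cat2l.
- by rewrite exa /= ex1; apply/(ldvd_cat2l [:: i])/ldvd_cat2l.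
- by rewrite eya /= ey1; apply/(ldvd_cat2l [:: i])/ldvd_cat2l.
Qed.

(** * Garside's fundamental word *)

Fixpoint delta k := if k is k'.+1 then iota 0 k' ++ delta k' else [::].

Lemma delta_letters k : all (fun i => i < k.-1) (delta k).
Proof.
elim: k => //= k IH; rewrite all_cat; apply/andP; split.
  by apply/allP => i; rewrite mem_iota.
by apply: sub_all IH => i; lia.
Qed.

Lemma beq_far_word i w : all (far i) w -> i :: w =b w ++ [:: i].
Proof.
elim: w => //= j w IH /andP [ij iw]; rewrite (beq_swap w ij).
by rewrite (IH iw).
Qed.

Lemma iota_shift k i : i.+1 < k -> iota 0 k ++ [:: i] =b i.+1 :: iota 0 k.
Proof.
move=> ik; have -> : k = i + (k - i.+2).+2 by lia.
rewrite iotaD add0n /= -catA /=.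
have fr : all (far i) (iota i.+2 (k - i.+2)).
  by apply/allP => j; rewrite mem_iota /far; lia.
have fl : all (far i.+1) (iota 0 i).
  by apply/allP => j; rewrite mem_iota /far; lia.
rewrite -(beq_far_word fr) -cat_cons (beq_far_word fl) -catA /=.
have nr : near i i.+1 by rewrite /near eqxx.
by rewrite (beq_braid _ nr).
Qed.

Lemma iota_shift_word k w : all (fun i => i.+1 < k) w ->
  map S w ++ iota 0 k =b iota 0 k ++ w.
Proof.
elim: w => [|i w IH] /=; first by rewrite cats0.
by case/andP=> ik /IH ->; rewrite -cat_cons -(iota_shift ik) -catA.
Qed.

(** Conjugation by the fundamental word reverses the order of the letters; the
    index [j] is the mirror image of [i]. *)
Lemma delta_conj k i j : i + j + 2 = k -> delta k ++ [:: i] =b j :: delta k.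
Proof.
elim: k i j => [|k IH] i j; first by lia.
case: j => [|j] e; last first.
  have e' : i + j + 2 = k by lia.
  have jk : j.+1 < k by lia.
  rewrite /= -catA (IH _ _ e') -cat_cons -(iota_shift jk) -catA.
  by [].
case: k e IH => [|k] e _; first by lia.
have -> : i = k by lia.
have -> : delta k.+2 = iota 0 k.+1 ++ iota 0 k ++ delta k by [].
have fk : all (far k) (delta k).
  by apply: sub_all (delta_letters k) => l; rewrite /far; lia.
rewrite -!catA -(beq_far_word fk).
have -> : iota 0 k ++ k :: delta k = iota 0 k.+1 ++ delta k.
  by rewrite -[k.+1]addn1 iotaD -catA.
have e0 : iota 0 k.+1 = 0 :: map S (iota 0 k).
  by rewrite /= -[1]addn0 iotaDl.
rewrite {1}e0 cat_cons (catA (map S _)) iota_shift_word -?catA //.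
by apply/allP => l; rewrite mem_iota; lia.
Qed.

Lemma ldvd_letter_delta k i : i.+1 < k -> ldvd [:: i] (delta k).
Proof.
elim: k i => // k IH [|i] ik.
  by case: k ik {IH} => // k _; exists (iota 1 k ++ delta k.+1).
have [c e] := IH i ik; exists (iota 0 k ++ c).
by rewrite /= e catA iota_shift.
Qed.

Lemma delta_mirror k w : all (fun i => i < k.-1) w ->
  delta k ++ w =b map (fun i => k - i.+2) w ++ delta k.
Proof.
elim: w => [|i w IH] /=; first by rewrite cats0.
case/andP=> ik /IH <-; have e : i + (k - i.+2) + 2 = k by lia.
by rewrite -cat_cons -(delta_conj e) -catA.
Qed.

Lemma mirror_letters k w : all (fun i => i < k.-1) w ->
  all (fun i => i < k.-1) (map (fun i => k - i.+2) w).
Proof. by move=> wk; rewrite all_map; apply: sub_all wk => i /=; lia. Qed.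

Lemma mirrorK k w : all (fun i => i < k.-1) w ->
  map (fun i => k - i.+2) (map (fun i => k - i.+2) w) = w.
Proof.
move/allP=> wk; rewrite -map_comp map_id_in // => i /wk /=; lia.
Qed.

(** Let [j] be the last letter of [s].  By Garside's theorem a letter other than
    [j] that starts [j :: r] starts [r].  If [i] does not start [r], then by
    induction the rest of [s] ends with [i]; when [i] and [j] are near, the same
    argument moves one letter further and shows that [s] ends with [j], [i],
    [j], which is [i], [j], [i]. *)
Lemma letter_splitting m d s r i :
  (forall j, j < m -> ldvd [:: j] d) -> all (fun j => j < m) s -> i < m ->
  d =b s ++ r -> ldvd [:: i] r \/ exists s', s =b s' ++ [:: i].
Proof.
move=> md; have [N leN] := ubnP (size s); elim: N => // N IH in s r i leN *.
case: (lastP s) leN => [|s1 j] leN.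
  by move=> _ /md di ed; left; move: ed => /= <-.
rewrite size_rcons in leN.
rewrite all_rcons -cats1 -catA => /andP [jm s1m] im /= ed.
have [[u]|s1i] := IH s1 (j :: r) i leN s1m im ed.
- move=> /beq_sym eiu.
  case: (lettersP i j) => [<-|ij|ij]; first by right; exists s1.
    by have [w _ ->] := garside_far ij eiu; left; exists w.
  by have [w _ ->] := garside_near ij eiu; left; exists (j :: w).
case: s1i => s2 e1.
have s2m : all (fun j => j < m) s2.
  by move: s1m; rewrite (beq_all _ e1) all_cat => /andP [].
case: (lettersP i j) => [<-|ij|ij]; first by right; exists s1.
  right; exists (s2 ++ [:: j]); rewrite e1 -!catA /=.
  by rewrite (beq_swap _ ij).
have sz2 : size s2 < N by move: (beq_size e1) leN; rewrite size_cat /=; lia.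
have ed2 : d =b s2 ++ i :: j :: r by rewrite ed e1 -catA.
have [[u /= e2]|[s3 e3]] := IH s2 _ j sz2 s2m jm ed2.
  have [w e3 _] := garside_near ij e2; left; exists w.
  exact: (@beq_catI [:: j]).
right; exists (s3 ++ [:: i; j]); rewrite e1 e3 -!catA /=.
by rewrite (beq_braid [::] ij).
Qed.

(** * Squares in the fundamental word *)

Definition swap_at i (f : nat -> nat) k :=
  if k == i then f i.+1 else if k == i.+1 then f i else f k.

(** The nil-Coxeter action on sequences of numbers: a letter exchanges two
    consecutive entries in increasing order and is undefined on the others, so
    a word containing a square acts nowhere. *)
Fixpoint sort_by w (f : nat -> nat) : option (nat -> nat) :=
  if w is i :: w' then
    if f i < f i.+1 then sort_by w' (swap_at i f) else None
  else Some f.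

Lemma sort_by_cat u v f : sort_by (u ++ v) f = obind (sort_by v) (sort_by u f).
Proof. by elim: u f => //= i u IH f; case: ifP. Qed.

Lemma swap_at1 i f : swap_at i f i = f i.+1.
Proof. by rewrite /swap_at eqxx. Qed.

Lemma swap_at2 i f : swap_at i f i.+1 = f i.
Proof. by rewrite /swap_at eqxx gtn_eqF. Qed.

Lemma swap_at_id i f k : k != i -> k != i.+1 -> swap_at i f k = f k.
Proof. by rewrite /swap_at => /negbTE -> /negbTE ->. Qed.

Lemma beq_sort_by u v f : u =b v -> sort_by u f = sort_by v f.
Proof.
move=> e; elim: e f => {u v} [//|//|u v w _ e1 _ e2|a u v b _ e|i j ij|i] f.
- by rewrite e1.
- rewrite !sort_by_cat; case: (sort_by a f) => //= g.
  by rewrite !sort_by_cat e.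
- rewrite /= !swap_at_id; try lia.
  case: ifP => fi; case: ifP => fj //; congr Some; apply: funext => k.
  by rewrite /swap_at; do ![case: eqP => ? //; try lia]; try (congr f; lia).
- rewrite /= !(swap_at1, swap_at2) !(@swap_at_id i _ i.+2); try lia.
  rewrite !(@swap_at_id i.+1 _ i); try lia.
  rewrite !swap_at1 !swap_at2.
  case: (ltnP (f i) (f i.+1)) => f01; case: (ltnP (f i.+1) (f i.+2)) => f12;
    case: (ltnP (f i) (f i.+2)) => f02 //; try lia.
  congr Some; apply: funext => k.
  by rewrite /swap_at; do ![case: eqP => ? //; try lia]; try (congr f; lia).
Qed.

Lemma sort_by_iota m a f : (forall j, a < j <= a + m -> f a < f j) ->
  exists2 g, sort_by (iota a m) f = Some g &
    forall j, j < a + m -> g j = if j < a then f j else f j.+1.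
Proof.
elim: m a f => [|m IH] a f fa /=.
  by exists f => // j; rewrite addn0 => ->.
rewrite fa; last by lia.
have [|g eg gE] := IH a.+1 (swap_at a f).
  by move=> j ja; rewrite swap_at2 swap_at_id ?fa; lia.
exists g => // j ja; rewrite gE; last by lia.
case: (ltngtP j a) => [ja'|ja'|->].
- by rewrite ifT ?swap_at_id; lia.
- by rewrite ifF ?swap_at_id; lia.
- by rewrite ltnS leqnn swap_at1.
Qed.

(** The first block of [delta k] moves the least entry behind the other ones and
    leaves them increasing, ready for the next block. *)
Lemma sort_by_delta k f : (forall i j, i < j < k -> f i < f j) ->
  sort_by (delta k) f <> None.
Proof.
elim: k f => //= k IH f fk; rewrite sort_by_cat.
have [|g -> gE] /= := @sort_by_iota k 0 f; first by move=> j jk; apply: fk; lia.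
by apply: IH => i j ij; rewrite !gE /=; try lia; apply: fk; lia.
Qed.

Lemma delta_squarefree k u i v : ~ delta k =b u ++ [:: i, i & v].
Proof.
move=> e; apply: (@sort_by_delta k id); first by move=> ? ? /andP [].
rewrite (beq_sort_by _ e) sort_by_cat; case: (sort_by u id) => //= f.
by case: ifP => // fi; rewrite swap_at1 swap_at2 ltnNge ltnW.
Qed.

(** * Embedding of positive words in the braid group *)

Definition twist n k := flatten (nseq k (delta n ++ delta n)).

Lemma twistD n a b : twist n (a + b) = twist n a ++ twist n b.
Proof. by rewrite /twist nseqD flatten_cat. Qed.

Lemma twist_central n k w : all (fun i => i < n.-1) w ->
  w ++ twist n k =b twist n k ++ w.
Proof.
move=> wn; elim: k => [|k IH]; first by rewrite cats0.
have t1 : twist n 1 = delta n ++ delta n by rewrite /twist /= cats0.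
rewrite -[k.+1]addn1 twistD t1 catA IH -!catA (delta_mirror wn).
rewrite (catA (delta n) (map _ w)) (delta_mirror (mirror_letters wn)).
by rewrite mirrorK // -catA.
Qed.

Section Embedding.
Variables (n : nat) (comp : nat -> seq nat).
Hypothesis compE : forall i, i < n.-1 -> i :: comp i =b delta n ++ delta n.

(** A braid word multiplied by enough full twists: each inverse letter becomes
    the completion of that letter into a full twist. *)
Definition clear_inverses (w : braid_word n) : seq nat :=
  flatten [seq if l.2 then comp (val l.1) else [:: val l.1] | l <- w].

Definition inverses (w : braid_word n) := count snd w.

Lemma comp_letters i : i < n.-1 -> all (fun i => i < n.-1) (comp i).
Proof.
move=> im; have := beq_all (fun i => i < n.-1) (compE im).
by rewrite /= im all_cat delta_letters.
Qed.

Lemma clear_inverses_letters w : all (fun i => i < n.-1) (clear_inverses w).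
Proof.
elim: w => //= -[i b] w IH; rewrite /clear_inverses /= all_cat.
by apply/andP; split=> //; case: b => /=; rewrite ?comp_letters ?ltn_ord.
Qed.

Lemma clear_inverses_cat u v :
  clear_inverses (u ++ v) = clear_inverses u ++ clear_inverses v.
Proof. by rewrite /clear_inverses map_cat flatten_cat. Qed.

(** Clearing the inverses of both words with the same number of full twists
    turns equality in the group into congruence of positive words. *)
Lemma braid_equiv_clear u v : braid_equiv u v ->
  clear_inverses u ++ twist n (inverses v)
    =b clear_inverses v ++ twist n (inverses u).
Proof.
elim=> {u v} [w|u v _ IH|u v w _ IHu _ IHv|a u v b _ IH|i b|i j ij|i j ij].
- by [].
- exact: beq_sym.
- apply: (@beq_catIr (twist n (inverses v))).
  rewrite -!catA -!twistD ![_ + inverses v]addnC !twistD !catA IHu.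
  by rewrite -!catA -!twistD addnC twistD catA IHv -!catA -!twistD addnC.
- rewrite !clear_inverses_cat /inverses !count_cat -!/(inverses _).
  have mid p q : clear_inverses p ++ clear_inverses b ++
      twist n (inverses a + (inverses q + inverses b))
      =b (clear_inverses p ++ twist n (inverses q)) ++
         clear_inverses b ++ twist n (inverses a + inverses b).
    rewrite addnCA twistD -!catA; apply: cat_beq_proper; first by [].
    by rewrite catA (twist_central _ (clear_inverses_letters b)) -catA.
  rewrite -!catA; apply: cat_beq_proper; first by [].
  by rewrite !mid IH.
- rewrite /clear_inverses /inverses /= cats0.
  have e := compE (ltn_ord i).
  case: b => /=; rewrite ?cats0.
    apply: (@beq_catI [:: val i]).
    rewrite addn0 /= -cat_cons e -[_ ++ [:: _]]/(_ ++ [:: val i]).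
    have := @twist_central n 1 [:: val i].
    by rewrite /twist /= cats0 => -> //; rewrite ltn_ord.
  by rewrite e /twist /= cats0.
- by rewrite /clear_inverses /inverses /=; apply: beq_swap.
- by rewrite /clear_inverses /inverses /=; apply: beq_braid.
Qed.
End Embedding.

Definition positive_word n (w : seq 'I_n.-1) : braid_word n :=
  [seq (i, false) | i <- w].

(** The positive monoid embeds in the group because full twists are central and
    cancellable. *)
Theorem positive_embedding n (u v : seq 'I_n.-1) :
  braid_equiv (positive_word u) (positive_word v) -> map val u =b map val v.
Proof.
have [comp compE] : {comp : nat -> seq nat &
    forall i, i < n.-1 -> i :: comp i =b delta n ++ delta n}.
  apply: (@choice _ _ (fun i c => i < n.-1 -> i :: c =b _)) => i.
  case: (ltnP i n.-1) => [im|]; last by exists [::].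
  have [|c e] := @ldvd_letter_delta n i; first by lia.
  by exists (c ++ delta n) => _; rewrite e.
move=> /(braid_equiv_clear compE).
have clear w : clear_inverses comp (@positive_word n w) = map val w.
  elim: w => //= i w IH.
  by rewrite /clear_inverses /= -/(clear_inverses _ _) IH.
have inv w : inverses (@positive_word n w) = 0.
  by rewrite /inverses count_map; elim: w.
by rewrite !clear !inv !cats0.
Qed.

(** * Transfer to positive braids *)

Local Open Scope group_scope.

(** Letters that are too large for [n] strands are dropped. *)
Definition braid_of n (w : seq nat) : pbraid n :=
  \prod_(i <- pmap insub w) sigma i.

Notation on_strands n w := (all (fun i => i < n.-1) w).

Section Transfer.
Variable n : nat.
Implicit Types (u v w : seq nat) (x y z a b c : pbraid n).

Lemma braid_of_cat u v : braid_of n (u ++ v) = braid_of n u * braid_of n v.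
Proof. by rewrite /braid_of pmap_cat big_cat. Qed.

Lemma braid_of_letter (i : 'I_n.-1) : braid_of n [:: val i] = sigma i.
Proof. by rewrite /braid_of /= valK big_seq1. Qed.

Lemma braid_of_surj x : exists2 w, on_strands n w & x = braid_of n w.
Proof.
case: x => x px; have /asboolP [w ew] := px.
exists (map val w); first by apply/allP => _ /mapP [i _ ->] /=.
apply: val_inj; rewrite /braid_of (map_pK valK) /= ew.
by elim: w {ew px} => [|i w IH]; rewrite ?big_nil ?big_cons ?valM ?val1 // IH.
Qed.

Lemma val_braid_of (w : seq 'I_n.-1) :
  val (braid_of n (map val w)) = braid_of_word (positive_word w).
Proof.
rewrite /braid_of (map_pK valK); elim: w => [|i w IH].
  by rewrite big_nil val1.
by rewrite big_cons valM IH; exact: (braid_mulE [:: (i, false)]).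
Qed.

Lemma on_strandsP w :
  on_strands n w -> exists w' : seq 'I_n.-1, w = map val w'.
Proof.
move=> wn; exists (pmap insub w).
rewrite (pmap_filter (insubK _)); apply/esym/all_filterP.
by apply: sub_all wn => i im; rewrite insubT.
Qed.

Lemma beq_on_strands u v : u =b v -> on_strands n u -> on_strands n v.
Proof. by move=> e; rewrite (beq_all _ e). Qed.

Lemma beq_braid_of u v :
  u =b v -> on_strands n u -> braid_of n u = braid_of n v.
Proof.
move=> e; elim: e => {u v}
    [//|u v e IH|u v w e1 IH1 _ IH2|a u v b _ IH|i j ij|i].
- by move=> vn; rewrite IH // (beq_on_strands (beq_sym e)).
- by move=> un; rewrite IH1 // IH2 // (beq_on_strands e1).
- by rewrite !all_cat !braid_of_cat => /and3P [_ un _]; rewrite IH.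
- move=> /= /and3P [im jm _].
  rewrite -[i]/(val (Ordinal im)) -[j]/(val (Ordinal jm)).
  apply: val_inj.
  rewrite (val_braid_of [:: Ordinal im; Ordinal jm]).
  rewrite (val_braid_of [:: Ordinal jm; Ordinal im]).
  by apply/braid_of_wordP/braid_equiv_far; rewrite /= ij.
- move=> /= /and4P [im jm _ _].
  rewrite -[i.+1]/(val (Ordinal jm)) -[i]/(val (Ordinal im)).
  apply: val_inj.
  rewrite (val_braid_of [:: Ordinal im; Ordinal jm; Ordinal im]).
  rewrite (val_braid_of [:: Ordinal jm; Ordinal im; Ordinal jm]).
  by apply/braid_of_wordP/braid_equiv_near; rewrite /= eqxx.
Qed.

Lemma braid_of_inj u v : on_strands n u -> on_strands n v ->
  braid_of n u = braid_of n v -> u =b v.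
Proof.
move=> /on_strandsP [u' ->] /on_strandsP [v' ->] /(congr1 val).
by rewrite !val_braid_of => /braid_of_wordP/positive_embedding.
Qed.

Lemma ldiv_braid_of u v : on_strands n u -> on_strands n v ->
  ldiv (braid_of n u) (braid_of n v) <-> ldvd u v.
Proof.
move=> un vn; split=> [[z]|[c e]].
  have [c cn ->] := braid_of_surj z; rewrite -braid_of_cat => /braid_of_inj e.
  by exists c; apply: e; rewrite // all_cat un.
by exists (braid_of n c); rewrite -braid_of_cat; apply: beq_braid_of.
Qed.

Lemma rdiv_braid_of u v : on_strands n u -> on_strands n v ->
  rdiv (braid_of n u) (braid_of n v) <-> ldvd (rev u) (rev v).
Proof.
move=> un vn; split=> [[z]|[c /beq_rev]].
  have [c cn ->] := braid_of_surj z; rewrite -braid_of_cat => /braid_of_inj e.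
  by exists (rev c); rewrite -rev_cat; apply/beq_rev/e; rewrite // all_cat cn.
rewrite rev_cat !revK => e; exists (braid_of n (rev c)).
by rewrite -braid_of_cat; apply: beq_braid_of.
Qed.

Lemma ldvd_on_strands u v : ldvd u v -> on_strands n v -> on_strands n u.
Proof. by case=> c /beq_on_strands h /h; rewrite all_cat => /andP []. Qed.

Lemma braid_of_delta : braid_of n (delta n) = Delta n.
Proof.
suff main k : k <= n -> braid_of n (delta k) = Delta_rec n k by exact: main.
elim: k => [_|k IH kn]; first by rewrite /braid_of big_nil.
rewrite /= braid_of_cat IH ?(ltnW kn) //; congr (_ * _).
under eq_bigr do rewrite -braid_of_letter.
rewrite -(big_ord_widen _ (fun i => braid_of n [:: i])); last by lia.
rewrite -(big_mkord xpredT (fun i => braid_of n [:: i])) /index_iota subn0.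
elim: (iota 0 k) => [|i w IHw]; first by rewrite /braid_of !big_nil.
by rewrite big_cons -IHw -braid_of_cat.
Qed.

(** * Divisibility of positive braids *)

Lemma pmulI x : injective (fun y => x * y).
Proof. by move=> y z /(congr1 val); rewrite !valM => /mulgI/val_inj. Qed.

Lemma pmulIr x : injective (fun y => y * x).
Proof. by move=> y z /(congr1 val); rewrite !valM => /mulIg/val_inj. Qed.

Lemma ldiv_trans x y z : ldiv x y -> ldiv y z -> ldiv x z.
Proof. by case=> c -> [d ->]; exists (c * d); rewrite mulgA. Qed.

Lemma ldiv_mul x y : ldiv x (x * y). Proof. by exists y. Qed.

Lemma ldiv_mul2l x y z : ldiv (x * y) (x * z) <-> ldiv y z.
Proof.
split=> -[c]; last by move=> ->; exists c; rewrite mulgA.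
by rewrite -mulgA => /pmulI ->; exists c.
Qed.

Lemma ldiv_interp a b x y : ldiv a x -> ldiv b x -> ldiv a y -> ldiv b y ->
  exists m, [/\ ldiv a m, ldiv b m, ldiv m x & ldiv m y].
Proof.
have [u un ->] := braid_of_surj a; have [v vn ->] := braid_of_surj b.
have [w wn ->] := braid_of_surj x; have [t tn ->] := braid_of_surj y.
rewrite !ldiv_braid_of // => uw vw ut vt.
have [m [um vm mw mt]] := ldvd_interp uw vw ut vt.
have mn := ldvd_on_strands mw wn.
by exists (braid_of n m); split; apply/ldiv_braid_of.
Qed.

Lemma rdiv_interp a b x y : rdiv a x -> rdiv b x -> rdiv a y -> rdiv b y ->
  exists m, [/\ rdiv a m, rdiv b m, rdiv m x & rdiv m y].
Proof.
have [u un ->] := braid_of_surj a; have [v vn ->] := braid_of_surj b.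
have [w wn ->] := braid_of_surj x; have [t tn ->] := braid_of_surj y.
rewrite !rdiv_braid_of // => uw vw ut vt.
have [m [um vm mw mt]] := ldvd_interp uw vw ut vt.
have mn : on_strands n (rev m).
  by rewrite all_rev; apply: (ldvd_on_strands mw); rewrite all_rev.
by exists (braid_of n (rev m)); split; apply/rdiv_braid_of; rewrite ?revK.
Qed.

Lemma letter_dvd_neq1 x : x <> 1 -> exists i : 'I_n.-1, ldiv (sigma i) x.
Proof.
have [[|i w] wn ->] := braid_of_surj x; first by rewrite /braid_of big_nil.
move: wn => /= /andP [im _] _; exists (Ordinal im).
by rewrite -braid_of_letter -(cat1s i w) braid_of_cat; apply: ldiv_mul.
Qed.

Lemma letter_ndvd1 (i : 'I_n.-1) : ~ ldiv (sigma i) 1.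
Proof.
have -> : 1 = braid_of n [::] by rewrite /braid_of big_nil.
rewrite -braid_of_letter ldiv_braid_of //=; last by rewrite ltn_ord.
by case=> c /beq_size.
Qed.

(** * Simple braids *)

Lemma delta_on_strands : on_strands n (delta n).
Proof. exact: delta_letters. Qed.

Lemma mirror x :
  exists x', Delta n * x = x' * Delta n /\ x * Delta n = Delta n * x'.
Proof.
have [w wn ->] := braid_of_surj x; have mn := mirror_letters wn.
exists (braid_of n (map (fun i => (n - i.+2)%N) w)).
rewrite -braid_of_delta -!braid_of_cat; split.
  apply: beq_braid_of (delta_mirror wn) _.
  by rewrite all_cat delta_on_strands.
rewrite -{1}(mirrorK wn); apply/esym/(beq_braid_of (delta_mirror mn)).
by rewrite all_cat delta_on_strands.
Qed.

(** Conjugation by [Delta] carries a complement from one side to the other. *)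
Lemma simple_rdiv x : simple x <-> rdiv x (Delta n).
Proof.
split=> -[z e].
  have [z' [ez _]] := mirror z; exists z'; apply: (@pmulIr z).
  by rewrite -mulgA -e.
have [z' [_ ez]] := mirror z; exists z'; apply: (@pmulI z).
by rewrite mulgA -e.
Qed.

Lemma simple_mull x y : simple (x * y) -> simple x.
Proof. exact/ldiv_trans/ldiv_mul. Qed.

Lemma simple_mulr x y : simple (x * y) -> simple y.
Proof.
move/simple_rdiv => [z e]; apply/simple_rdiv; exists (z * x).
by rewrite e mulgA.
Qed.

Lemma simple_square x (i : 'I_n.-1) :
  rdiv (sigma i) x -> ~ simple (x * sigma i).
Proof.
case=> y -> [z]; have [u un ->] := braid_of_surj y.
have [w wn ->] := braid_of_surj z.
rewrite -braid_of_delta -braid_of_letter -!braid_of_cat => /braid_of_inj e.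
have im : on_strands n [:: val i] by rewrite /= ltn_ord.
apply: (@delta_squarefree n u (val i) w); rewrite -!catA /= in e; apply: e.
  exact: delta_on_strands.
by rewrite all_cat un /= ltn_ord.
Qed.

(** By [letter_splitting], a letter that does not end [x] starts the complement
    of [x] in [Delta]. *)
Lemma simple_extend x (i : 'I_n.-1) :
  simple x -> ~ rdiv (sigma i) x -> simple (x * sigma i).
Proof.
move=> [z e]; have [u un eu] := braid_of_surj x.
have [w wn ew] := braid_of_surj z.
have [] := @letter_splitting n.-1 (delta n) u w i.
- by move=> j jn; apply: ldvd_letter_delta; lia.
- exact: un.
- exact: ltn_ord.
- apply: braid_of_inj; rewrite ?delta_on_strands ?all_cat ?un //.
  by rewrite braid_of_delta braid_of_cat -eu -ew.
- move=> iw _; rewrite /simple e ldiv_mul2l ew -braid_of_letter.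
  by apply/ldiv_braid_of => //=; rewrite ltn_ord.
- move=> [u' e'] []; exists (braid_of n u').
  by rewrite eu (beq_braid_of e' un) braid_of_cat braid_of_letter.
Qed.

(** * Greedy pairs *)

(** The form in which normality of a pair is carried through the grid. *)
Definition greedy a b := forall d, simple d -> ldiv d (a * b) -> ldiv d a.

(** If [a] does not end with a letter that starts [b], then [a] extended by that
    letter is a simple divisor of [a * b].  Conversely a simple divisor not
    contained in [a] makes [a] extend by a letter of [b] inside a simple
    braid. *)
Lemma greedyP a b : simple a ->
  greedy a b <-> forall i, ldiv (sigma i) b -> rdiv (sigma i) a.
Proof.
move=> sa; split=> [gab i ib|ab d sd dab].
  apply: contrapT => /(simple_extend sa) si.
  have /gab : simple (a * sigma i) by [].
  rewrite ldiv_mul2l => /(_ ib); rewrite -{2}[a]mulg1 ldiv_mul2l.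
  exact: letter_ndvd1.
have [m [dm [c em] mab sm]] := ldiv_interp dab (ldiv_mul a b) sd sa.
case: (EM (c = 1)) => [c1|/letter_dvd_neq1 [i ic]].
  by move: dm; rewrite em c1 mulg1.
have := @simple_square a i (ab i _); case.
  by apply: ldiv_trans ic _; move: mab; rewrite em ldiv_mul2l.
by apply: ldiv_trans sm; rewrite em ldiv_mul2l.
Qed.

Lemma normalP (s : seq (pbraid n)) : normal s <->
  {in s, forall x, simple x} /\
  (forall k, k.+1 < size s -> greedy (nth 1 s k) (nth 1 s k.+1)).
Proof.
split=> -[ss sn]; split=> // k ks; last by apply/greedyP/sn/ks/ss/mem_nth/ltnW.
by apply/greedyP/sn/ks; exact/ss/mem_nth/ltnW.
Qed.

Lemma greedy_mull c a b : simple (c * a) -> greedy a b -> greedy (c * a) b.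
Proof.
move=> sca gab d sd; rewrite -mulgA => dcab.
have [m [dm [e em] mcab sm]] :=
  ldiv_interp dcab (ldiv_mul c (a * b)) sd (simple_mull sca).
apply: ldiv_trans dm _; rewrite em in mcab sm *; apply/ldiv_mul2l/gab.
  exact: simple_mulr sm.
by move: mcab; rewrite ldiv_mul2l.
Qed.

(** * Tiles *)

(** The labels of a square are top [a], right [b], left [c] and bottom [d].
    Minimality of the diagonal is stated on both cofactors of a common left
    multiple at once, which lets squares be pasted without cancellation. *)
Definition lcm_square a b c d :=
  a * b = c * d /\
  forall e f, e * b = f * d -> exists k, e = k * a /\ f = k * c.

(** A common left multiple of the bottom and right edges that is a proper right
    divisor of the diagonal leaves a common left divisor of the top and left
    edges; interpolation between the diagonal and any other common multiple
    produces one that divides both. *)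
Lemma tile_lcm_square a b c d :
  a * b = c * d -> is_gcdL a c 1 -> lcm_square a b c d.
Proof.
move=> e [_ _ ac1]; split=> // x y exy.
have bab : rdiv b (a * b) by exists a.
have dab : rdiv d (a * b) by rewrite e; exists c.
have bxb : rdiv b (x * b) by exists x.
have dxb : rdiv d (x * b) by rewrite exy; exists y.
have [m [[b' bm] [d' dm] [k km] [l lm]]] := rdiv_interp bab dab bxb dxb.
have ea : a = k * b' by apply: (@pmulIr b); rewrite km bm mulgA.
have ec : c = k * d' by apply: (@pmulIr d); rewrite -e km dm mulgA.
have ex : x = l * b' by apply: (@pmulIr b); rewrite lm bm mulgA.
have ey : y = l * d' by apply: (@pmulIr d); rewrite -exy lm dm mulgA.
have [||k' /esym ek] := ac1 k; [by exists b' | by exists d' |].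
have ek' : k' * k = 1 by apply: (@pmulI k); rewrite mulgA ek mul1g mulg1.
exists (l * k').
by rewrite ea ec ex ey -!mulgA !(mulgA k') ek' !mul1g.
Qed.

Lemma lcm_squareP a b c d : lcm_square a b c d -> is_lcmL d b (a * b).
Proof.
case=> e lcm; split; [by exists c | by exists a |].
move=> m [f ->] [g efg]; have [k [eg _]] := lcm g f (esym efg).
by exists k; rewrite efg eg mulgA.
Qed.

Lemma lcm_square_sym a b c d : lcm_square a b c d -> lcm_square c d a b.
Proof.
by case=> e lcm; split=> // f g /esym/lcm [k [-> ->]]; exists k.
Qed.

Lemma lcm_square_row a1 a2 b c d1 d2 m :
  lcm_square a1 m c d1 -> lcm_square a2 b m d2 ->
  lcm_square (a1 * a2) b c (d1 * d2).
Proof.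
move=> [e1 lcm1] [e2 lcm2]; split.
  by rewrite -mulgA e2 mulgA e1 mulgA.
move=> x y; rewrite mulgA => /lcm2 [k [-> /esym/lcm1 [l [-> ->]]]].
by exists l; rewrite mulgA.
Qed.

Lemma lcm_square_col a b1 b2 c1 c2 d m :
  lcm_square a b1 c1 m -> lcm_square m b2 c2 d ->
  lcm_square a (b1 * b2) (c1 * c2) d.
Proof.
move=> [e1 lcm1] [e2 lcm2]; split.
  by rewrite mulgA e1 -mulgA e2 mulgA.
move=> x y; rewrite mulgA => /lcm2 [k [/lcm1 [l [-> ->]] ->]].
by exists l; rewrite mulgA.
Qed.

Lemma lcm_square_simple a b c d :
  lcm_square a b c d -> simple b -> simple d -> simple (a * b).
Proof.
move=> /lcm_squareP [_ _ lcm] /simple_rdiv sb /simple_rdiv sd.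
exact/simple_rdiv/lcm.
Qed.

(** Normality of the bottom side of two adjacent tiles passes to the top side:
    the diagonal of the left tile contains every simple divisor of the top
    side, and the right tile leaves nothing of it beyond the first edge. *)
Lemma greedy_top (h1 h2 v0 v1 v2 h1' h2' : pbraid n) :
  lcm_square h1 v1 v0 h1' -> h2 * v2 = v1 * h2' -> is_gcdL h2 v1 1 ->
  simple h1' -> simple v1 -> greedy h1' h2' -> greedy h1 h2.
Proof.
move=> sq1 e2 [_ _ g2] sh1 sv1 g d sd d12; have e1 := sq1.1.
have dd : ldiv d (h1 * v1).
  rewrite e1; apply: (greedy_mull _ g sd).
    by rewrite -e1; apply: lcm_square_simple sq1 sv1 sh1.
  by rewrite -e1 -mulgA -e2 mulgA; apply: ldiv_trans d12 (ldiv_mul _ _).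
have [m [dm [c em] m2 m1]] := ldiv_interp d12 (ldiv_mul _ _) dd (ldiv_mul _ _).
apply: ldiv_trans dm _; move: m1 m2; rewrite em !ldiv_mul2l => c1 c2.
by rewrite -{2}[h1]mulg1 ldiv_mul2l; apply: g2.
Qed.

(** A simple divisor of [A * (h * v')] may be enlarged to a multiple [A * c] of
    [A]; then [a * c] and [b * c] are simple, so the diagonals [a * v] and
    [b * h] next to [A] contain them, and [c] divides both the left and the top
    edge of the tile that follows [A]. *)
Lemma greedy_diagonal (A v0 a h0 b h v h' v' : pbraid n) :
  A = v0 * a -> A = h0 * b -> h * v' = v * h' -> is_gcdL h v 1 -> simple A ->
  greedy (a * v) h' -> greedy (b * h) v' -> greedy A (h * v').
Proof.
move=> Aa Ab e [_ _ g1] sA ga gb d sd dA.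
have [m [dm [c em] mA sm]] := ldiv_interp dA (ldiv_mul _ _) sd sA.
apply: ldiv_trans dm _; move: sm mA; rewrite em ldiv_mul2l => sm cB.
rewrite -{2}[A]mulg1 ldiv_mul2l; apply: g1.
- rewrite -(ldiv_mul2l b); apply: gb; last by rewrite -mulgA ldiv_mul2l.
  by apply: (@simple_mulr h0); rewrite mulgA -Ab.
- rewrite -(ldiv_mul2l a); apply: ga; last by rewrite -mulgA ldiv_mul2l -e.
  by apply: (@simple_mulr v0); rewrite mulgA -Aa.
Qed.
End Transfer.

(** * Grids *)

Lemma prod_recr (M : monoidType) k (F : nat -> M) :
  \prod_(1 <= i < k.+2) F i = \prod_(1 <= i < k.+1) F i * F k.+1.
Proof. exact: big_nat_recr. Qed.

Lemma prod_split (M : monoidType) q p (F : nat -> M) : q <= p ->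
  \prod_(1 <= i < p.+1) F i =
  \prod_(1 <= i < q.+1) F i * \prod_(k <- iota 1 (p - q)) F (q + k)%N.
Proof.
move=> qp; rewrite /index_iota !subn1 /= -{1}(subnKC qp) iotaD big_cat.
by rewrite addnC iotaDl big_map.
Qed.

Lemma grid_transpose n p q (s : p.-tuple (pbraid n)) (t : q.-tuple (pbraid n))
    h v : is_grid s t h v -> is_grid t s (fun i j => v j i) (fun i j => h j i).
Proof.
case=> sh sv bot right tile; split=> // i j; first by move=> ? ?; apply: sv.
  by move=> ? ?; apply: sh.
move=> iq jp; have [e [_ _ g]] := tile j i jp iq.
by split=> //; split=> [||d dv dh]; [exists (v j.-1 i) | exists (h j i.-1) |];
  rewrite ?mul1g //; apply: g.
Qed.

Section Grid.
Variables (n p q : nat) (s : p.-tuple (pbraid n)) (t : q.-tuple (pbraid n)).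
Variables h v : nat -> nat -> pbraid n.
Hypothesis hD : is_grid s t h v.

Lemma grid_square i j : 0 < i <= p -> 0 < j <= q ->
  lcm_square (h i j.-1) (v i j) (v i.-1 j) (h i j).
Proof.
by move=> ip jq; have [e g] := grid_tile hD ip jq; apply: tile_lcm_square.
Qed.

Lemma diag_simple i j : 0 < i <= p -> 0 < j <= q -> simple (diag h v i j).
Proof.
move=> ip jq; apply: lcm_square_simple (grid_square ip jq) _ _.
  by apply: (grid_simple_v hD) => //; lia.
by apply: (grid_simple_h hD) => //; lia.
Qed.

Lemma diagE i j : 0 < i <= p -> 0 < j <= q ->
  diag h v i j = v i.-1 j * h i j.
Proof. by move=> ip jq; case: (grid_square ip jq). Qed.

Lemma row_greedy i j : normal s -> 0 < i < p -> j <= q ->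
  greedy (h i j) (h i.+1 j).
Proof.
move=> /normalP [_ ns] ip jq; rewrite -(subKn jq).
elim: (q - j)%N (leq_subr j q) => [_|k IH kq].
  rewrite subn0 !(grid_bottom hD); try lia.
  by case: i ip => // i ip; apply: ns; rewrite size_tuple.
have jk : 0 < q - k <= q by lia.
have -> : (q - k.+1)%N = (q - k).-1 by lia.
have ip1 : 0 < i <= p by lia.
have ip2 : 0 < i.+1 <= p by lia.
have [e2 g2] := grid_tile hD ip2 jk.
apply: (greedy_top (grid_square ip1 jk) e2 g2).
- by apply: (grid_simple_h hD) => //; lia.
- by apply: (grid_simple_v hD) => //; lia.
- by apply: IH; lia.
Qed.

Lemma diag_row_greedy i j : normal s -> 0 < i < p -> 0 < j <= q ->
  greedy (diag h v i j) (h i.+1 j).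
Proof.
move=> ns ip jq; have ip' : 0 < i <= p by lia.
have := diag_simple ip' jq; rewrite (diagE ip' jq) => sd.
by apply: greedy_mull sd _; apply: row_greedy => //; lia.
Qed.

Lemma grid_strip i j : i <= p -> 0 < j <= q ->
  lcm_square (\prod_(1 <= k < i.+1) h k j.-1) (v i j) (v 0 j)
             (\prod_(1 <= k < i.+1) h k j).
Proof.
move=> + jq; elim: i => [_|i IH ip].
  rewrite !(big_geq (leqnn 1)); split=> [|e f]; first by rewrite mulg1 mul1g.
  by rewrite mulg1 => <-; exists e; rewrite mulg1.
rewrite !prod_recr.
apply: (lcm_square_row (IH (ltnW ip))).
by apply: (@grid_square i.+1 j) => //; lia.
Qed.

(** Least common multiples compose, so every rectangle of the grid is one. *)
Lemma grid_rect i j : i <= p -> j <= q ->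
  lcm_square (\prod_(1 <= k < i.+1) h k 0) (\prod_(1 <= l < j.+1) v i l)
             (\prod_(1 <= l < j.+1) v 0 l) (\prod_(1 <= k < i.+1) h k j).
Proof.
move=> ip; elim: j => [_|j IH jq].
  rewrite !(big_geq (leqnn 1)); split=> [|e f]; first by rewrite mulg1 mul1g.
  by rewrite mulg1 => ->; exists f; rewrite mulg1.
rewrite !prod_recr.
apply: (lcm_square_col (IH (ltnW jq))).
by apply: (@grid_strip i j.+1) => //; lia.
Qed.

Lemma prod_diag k : k <= p -> k <= q ->
  \prod_(1 <= l < k.+1) diag h v l l =
  (\prod_(1 <= l < k.+1) v 0 l) * \prod_(1 <= i < k.+1) h i k.
Proof.
elim: k => [|k IH] kp kq; first by rewrite !(big_geq (leqnn 1)) mulg1.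
have kp' : 0 < k.+1 <= p by lia.
have kq' : 0 < k.+1 <= q by lia.
rewrite !prod_recr IH ?(ltnW kp) ?(ltnW kq) // (diagE kp' kq').
have [e _] := grid_strip (ltnW kp) kq'.
by rewrite -!mulgA; congr (_ * _); rewrite !mulgA e.
Qed.

Lemma prod_bottom : \prod_(u <- s) u = \prod_(1 <= k < p.+1) h k q.
Proof.
rewrite (big_nth 1) size_tuple big_add1 !big_nat.
by apply: eq_bigr => k kp; rewrite (grid_bottom hD).
Qed.
End Grid.

Section GridPaths.
Variables (n p q : nat) (s : p.-tuple (pbraid n)) (t : q.-tuple (pbraid n)).
Variables h v : nat -> nat -> pbraid n.
Hypothesis hD : is_grid s t h v.
Hypotheses (ns : normal s) (nt : normal t).

Lemma diag_greedy i j : 0 < i < p -> 0 < j < q ->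
  greedy (diag h v i j) (diag h v i.+1 j.+1).
Proof.
move=> ip jq; have ip0 : 0 < i <= p by lia.
have ip1 : 0 < i.+1 <= p by lia.
have jq0 : 0 < j <= q by lia.
have jq1 : 0 < j.+1 <= q by lia.
have [e g] := grid_tile hD ip1 jq1.
apply: (greedy_diagonal (diagE hD ip0 jq0) erefl e g (diag_simple hD ip0 jq0)).
  exact: (diag_row_greedy hD ns ip jq1).
exact: (diag_row_greedy (grid_transpose hD) nt jq ip1).
Qed.

Lemma diag_row_normal i j a b : i + a + b <= p -> j + a <= q ->
  normal ([seq diag h v (i + k) (j + k) | k <- iota 1 a]
          ++ [seq h (i + a + k) (j + a) | k <- iota 1 b]).
Proof.
move=> ip jq; apply/normalP; split=> [x|k].
  rewrite mem_cat => /orP [] /mapP [k]; rewrite mem_iota => kb ->.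
    by apply: (diag_simple hD); lia.
  by apply: (grid_simple_h hD); lia.
rewrite size_cat !size_map !size_iota !nth_cat !size_map !size_iota => kab.
case: (ltnP k a) => ka; last first.
  rewrite ltnNge (leqW ka) /= !(nth_map 0%N) ?size_iota ?nth_iota; try lia.
  rewrite subSn // !add1n [(i + a + (k - a).+2)%N]addnS.
  by apply: (row_greedy hD ns); lia.
rewrite (nth_map 0%N) ?size_iota // nth_iota // !add1n.
case: (ltnP k.+1 a) => ka'.
  rewrite (nth_map 0%N) ?size_iota // nth_iota // !add1n !(addnS _ k.+1).
  by apply: diag_greedy; lia.
have -> : a = k.+1 by lia.
rewrite subnn (nth_map 0%N) ?size_iota ?nth_iota; try lia.
rewrite addn0 addn1.
by apply: (diag_row_greedy hD ns); lia.
Qed.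

Lemma grid_row_normal j : j <= q -> normal [seq h k j | k <- iota 1 p].
Proof.
by move=> jq; have := @diag_row_normal 0 j 0 p; rewrite !addn0 add0n; apply.
Qed.
End GridPaths.

Lemma diag_col_normal n p q (s : p.-tuple (pbraid n)) (t : q.-tuple (pbraid n))
    h v i j a b : is_grid s t h v -> normal s -> normal t ->
  i + a <= p -> j + a + b <= q ->
  normal ([seq diag h v (i + k) (j + k) | k <- iota 1 a]
          ++ [seq v (i + a) (j + a + k) | k <- iota 1 b]).
Proof.
move=> hD ns nt ip jq.
have := @diag_row_normal _ _ _ _ _ _ _ (grid_transpose hD) nt ns j i a b jq ip.
congr (normal (_ ++ _)); apply/eq_in_map => k; rewrite mem_iota => ka.
by rewrite [RHS](diagE hD); try lia.
Qed.

Theorem proposition2p7 (n : nat) (hn : 2 <= n) (p q : nat)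
    (s : p.-tuple (pbraid n)) (t : q.-tuple (pbraid n))
    (hs : normal s) (ht : normal t)
    (h v : nat -> nat -> pbraid n) (hD : is_grid s t h v) :
  (* (i): paths starting at (i, j), with a diagonal arrows followed by b
     horizontal (resp. vertical) arrows *)
  ((forall i j a b, i + a + b <= p -> j + a <= q ->
      normal ([seq diag h v (i + k) (j + k) | k <- iota 1 a]
              ++ [seq h (i + a + k) (j + a) | k <- iota 1 b]))
   /\
   (forall i j a b, i + a <= p -> j + a + b <= q ->
      normal ([seq diag h v (i + k) (j + k) | k <- iota 1 a]
              ++ [seq v (i + a) (j + a + k) | k <- iota 1 b])))
  /\
  (* (ii) *)
  (let x := \prod_(u <- s) u in
   let y := \prod_(u <- t) u in
   [/\ exists z : pbraid n, is_lcompl x y z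
                 /\ is_normal_form z [seq h i 0 | i <- iota 1 p],
       exists z : pbraid n, is_lcompl y x z
                 /\ is_normal_form z [seq v 0 j | j <- iota 1 q]
     & q <= p ->
       exists m : pbraid n, is_lcmL x y m
                 /\ is_normal_form m ([seq diag h v k k | k <- iota 1 q]
                                      ++ drop q s)]).
Proof.
split; first split.
- by move=> i j a b; apply: (diag_row_normal hD).
- by move=> i j a b; apply: (diag_col_normal hD).
move=> x y; have hD' := grid_transpose hD.
have ex : x = \prod_(1 <= k < p.+1) h k q by exact: prod_bottom hD.
have ey : y = \prod_(1 <= l < q.+1) v p l by exact: prod_bottom hD'.
have := grid_rect hD (leqnn p) (leqnn q); rewrite -ex -ey => sq.
split.
- exists (\prod_(1 <= k < p.+1) h k 0); split; first exact: (lcm_squareP sq).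
  split; first exact: (grid_row_normal hD).
  by rewrite big_map /index_iota subn1.
- exists (\prod_(1 <= l < q.+1) v 0 l); split.
    exact: (lcm_squareP (lcm_square_sym sq)).
  split; first exact: (grid_row_normal hD').
  by rewrite big_map /index_iota subn1.
move=> qp.
have eds : drop q s = [seq h (q + k)%N q | k <- iota 1 (p - q)].
  apply: (@eq_from_nth _ 1) => [|k].
    by rewrite size_drop size_tuple size_map size_iota.
  rewrite size_drop size_tuple => kpq.
  rewrite nth_drop (nth_map 0%N) ?size_iota // nth_iota // add1n addnS.
  by rewrite (grid_bottom hD) //; lia.
exists (\prod_(1 <= l < q.+1) v 0 l * x); split.
  by have [<- _] := sq; apply: lcm_squareP sq.
rewrite eds; split.
  by have := @diag_row_normal _ _ _ _ _ _ _ hD hs ht 0 0 q (p - q);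
    rewrite !add0n subnKC //; apply.
rewrite big_cat !big_map ex.
rewrite (prod_split _ qp) mulgA -(prod_diag hD) //.
by rewrite /index_iota subn1.
Qed.
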